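(* Let $G$ be the graph on vertices $v_1,\dots,v_6$ with edges $v_1v_2, v_2v_3, v_2v_4, v_3v_4, v_3v_5, v_4v_5, v_5v_6$, and let $H$ be the graph on vertices $v_1,\dots,v_6$ with edges $v_1v_2, v_1v_3, v_2v_3, v_3v_4, v_3v_5, v_3v_6, v_5v_6$. Let $Gr$ be an Abelian group of order $k$, let $s$ and $s'$ be $k$-Abelian signatures of $G$ and $H$ respectively with values in $Gr$, and let $\beta$ be a basis of $\mathbb{C}^k$ consisting of common eigenvectors of the permutation matrices $P_g$ for $g$ in the images of $s$ and $s'$. For $\mathbf{x}\in\beta$ put $$u=\lambda_{\mathbf x}(P_{s(1,2)}),\ v=\lambda_{\mathbf x}(P_{s(2,3)}),\ w=\lambda_{\mathbf x}(P_{s(2,4)}),\ x=\lambda_{\mathbf x}(P_{s(3,4)}),\ y=\lambda_{\mathbf x}(P_{s(3,5)}),\ z=\lambda_{\mathbf x}(P_{s(4,5)}),\ r=\lambda_{\mathbf x}(P_{s(5,6)}),$$ $$u_1=\lambda_{\mathbf x}(P_{s'(1,2)}),\ v_1=\lambda_{\mathbf x}(P_{s'(1,3)}),\ w_1=\lambda_{\mathbf x}(P_{s'(2,3)}),\ x_1=\lambda_{\mathbf x}(P_{s'(3,4)}),\ y_1=\lambda_{\mathbf x}(P_{s'(3,5)}),\ z_1=\lambda_{\mathbf x}(P_{s'(3,6)}),\ r_1=\lambda_{\mathbf x}(P_{s'(5,6)}).$$ If for every $\mathbf{x}\in\beta$ both $$\frac{w}{v}=\frac{y}{z}\qquad\text{and}\qquad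 2\left(\frac{xv}{w}+\frac{w}{xv}\right)=\frac{y_1r_1}{z_1}+\frac{z_1}{y_1r_1}+\frac{u_1w_1}{v_1}+\frac{v_1}{u_1w_1}$$ hold, then the graphs $G(s)$ and $H(s')$ are cospectral.
   Context: Two graphs are cospectral if their adjacency matrices have the same multiset of eigenvalues. Let $Gr=(\{g_0,\dots,g_{k-1}\},* )$ be an Abelian group of order $k$. For $g\in Gr$, $P_g$ is the $k\times k$ permutation matrix, with rows and columns indexed by $0,\dots,k-1$, given by $P_g(a,b)=1$ if $g_a*g=g_b$ and $0$ otherwise. These matrices commute and have common bases of eigenvectors in $\mathbb{C}^k$; for a common eigenvector $\mathbf x$, $\lambda_{\mathbf x}(P_g)$ denotes the eigenvalue with $P_g\mathbf x=\lambda_{\mathbf x}(P_g)\mathbf x$. For a simple graph $G$ with vertices $v_1,\dots,v_n$ and edge set $E$, let $\dot E=\{(i,j): i<j,\ \{v_i,v_j\}\in E\}$. A $k$-Abelian signature of $G$ is a map $s:\dot E\to Gr$. The lift $G(s)$ is the graph on vertex set $V(G)\times\{0,\dots,k-1\}$ in which, for each $(i,j)\in\dot E$ and $a,b\in\{0,\dots,k-1\}$, the vertices $(v_i,a)$ and $(v_j,b)$ are adjacent if and only if $s(i,j)*g_a=g_b$; there are no other edges. *)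

(* Defs.v *)
From HB Require Import structures.
From mathcomp Require Import all_boot all_order all_algebra all_fingroup.
From mathcomp Require Import reals complex.

Set Implicit Arguments.
Unset Strict Implicit.
Unset Printing Implicit Defensive.

Import GRing.Theory.
Local Open Scope ring_scope.

(* Complex numbers are [R[i]] for [R : realType]. *)

Record sgraph (T : finType) := SGraph {
  adj :> rel T;
  adj_sym : symmetric adj;
  adj_irrefl : irreflexive adj }.

Definition edge_rel (T : finType) (l : seq (T * T)) : rel T :=
  fun x y => ((x, y) \in l) || ((y, x) \in l).

Lemma edge_rel_sym (T : finType) (l : seq (T * T)) : symmetric (edge_rel l).
Proof. by move=> x y; rewrite /edge_rel orbC. Qed.

Lemma edge_rel_irrefl (T : finType) (l : seq (T * T)) :
  all (fun p => p.1 != p.2) l -> irreflexive (edge_rel l).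
Proof.
move=> /allP hl x; rewrite /edge_rel orbb.
by apply/negP => /hl /=; rewrite eqxx.
Qed.

Definition graph_of_edges (T : finType) (l : seq (T * T))
    (hl : all (fun p => p.1 != p.2) l) : sgraph T :=
  SGraph (edge_rel_sym l) (edge_rel_irrefl hl).

Definition adjmx (C : nzRingType) (T : finType) (G : sgraph T) : 'M[C]_#|T| :=
  \matrix_(i, j) (G (enum_val i) (enum_val j))%:R.

(* The eigenvalues listed with their algebraic multiplicities; the list is
   only meaningful up to permutation. *)
Definition eigenvalues (C : closedFieldType) (n : nat) (A : 'M[C]_n) : seq C :=
  sval (closed_field_poly_normal (char_poly A)).

Definition cospectral (C : closedFieldType) (T U : finType)
    (G : sgraph T) (H : sgraph U) : bool :=
  perm_eq (eigenvalues (adjmx C G)) (eigenvalues (adjmx C H)).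

Definition dotE (n : nat) (G : sgraph 'I_n) : {set 'I_n * 'I_n} :=
  [set p : 'I_n * 'I_n | (p.1 < p.2)%N && G p.1 p.2].

(* A signature [dotE G -> gT] is represented by a total function
   [s : 'I_n -> 'I_n -> gT]; the constructions below read [s i j] only for
   [(i, j) \in dotE G]. *)
Definition sig_image (n : nat) (gT : finGroupType) (G : sgraph 'I_n)
    (s : 'I_n -> 'I_n -> gT) : {set gT} :=
  [set s p.1 p.2 | p in dotE G].

Section Lift.
Variables (n k : nat) (gT : finGroupType) (g : 'I_k -> gT).
Variables (G : sgraph 'I_n) (s : 'I_n -> 'I_n -> gT).

Definition lift_arc : rel ('I_n * 'I_k) := fun p q =>
  ((p.1, q.1) \in dotE G) && (s p.1 q.1 * g p.2 == g q.2)%g.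

Definition lift_adj : rel ('I_n * 'I_k) := fun p q =>
  lift_arc p q || lift_arc q p.

Lemma lift_adj_sym : symmetric lift_adj.
Proof. by move=> p q; rewrite /lift_adj orbC. Qed.

Lemma lift_adj_irrefl : irreflexive lift_adj.
Proof. by move=> p; rewrite /lift_adj orbb /lift_arc inE /= ltnn. Qed.

Definition lift_graph : sgraph ('I_n * 'I_k)%type :=
  SGraph lift_adj_sym lift_adj_irrefl.

End Lift.

Definition group_perm_mx (C : nzRingType) (k : nat) (gT : finGroupType)
    (g : 'I_k -> gT) (h : gT) : 'M[C]_k :=
  \matrix_(a, b) ((g a * h)%g == g b)%:R.

(* The vertex v_i, for a numeral 1 <= i <= 6; its underlying index is i - 1. *)
Notation "''v_' i" := (@Ordinal 6 i.-1 isT) (at level 8, i at level 2).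

Definition edgesG : seq ('I_6 * 'I_6) :=
  [:: ('v_1, 'v_2); ('v_2, 'v_3); ('v_2, 'v_4); ('v_3, 'v_4);
      ('v_3, 'v_5); ('v_4, 'v_5); ('v_5, 'v_6)].

Definition edgesH : seq ('I_6 * 'I_6) :=
  [:: ('v_1, 'v_2); ('v_1, 'v_3); ('v_2, 'v_3); ('v_3, 'v_4);
      ('v_3, 'v_5); ('v_3, 'v_6); ('v_5, 'v_6)].

Definition graphG : sgraph 'I_6 := @graph_of_edges _ edgesG isT.
Definition graphH : sgraph 'I_6 := @graph_of_edges _ edgesH isT.

(* Main.v *)
Require Import Defs.
From mathcomp Require Import all_boot all_order all_algebra all_fingroup.
From mathcomp Require Import reals complex.
From mathcomp Require Import ring.

(** Let [Q] be the matrix whose columns are the vectors of [beta]. Every [P_h]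
    that occurs in a lift is diagonal in this basis, and so is its transpose:
    [P_h] is a permutation matrix, hence [P_h^T] is its inverse, with the
    inverse eigenvalues. The adjacency matrix of the lift, cut into blocks
    indexed by pairs of vertices of the base graph, has blocks [P_h], [P_h^T]
    or 0; conjugation by [1 (x) Q] therefore makes it a direct sum, over [X] in
    [beta], of matrices of the size of the base graph. The summand of [X] is the
    adjacency matrix of the base graph with each arc [(i, j)] of [dotE] weighted
    by the eigenvalue [l] of [P_(s i j)] on [X], and the reversed arc by [l^-1]
    ([quotient_mx]). So the characteristic polynomial of the lift is the product
    of the characteristic polynomials of these matrices ([char_poly_lift]), and
    two lifts by the same group are cospectral as soon as the factors agree
    for each [X].

    It remains to compare the factors of G and H. A weighted matrix of
    this kind has a characteristic polynomial whose coefficients count disjoint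
    unions of edges and cycles. An edge contributes the product of two inverse
    weights, that is 1, and a cycle contributes its weight plus the inverse of
    that weight. Write [tau] for the sum of the contributions of the two triangles.
    - Both graphs have 7 edges and one perfect matching, and in both each
      triangle is disjoint from exactly one edge. This gives
      [t^6 - 7 t^4 - tau t^3 + c t^2 + tau t - 1] for both.
    - H has 7 pairs of disjoint edges and no cycle besides its triangles,
      so [c = 7]. G has 9 such pairs and one cycle besides its triangles, the
      4-cycle [v_2 v_4 v_5 v_3], of contribution [q], so [c = 9 - q].
    The condition [w / v = y / z] says that this 4-cycle has weight 1. Then
    [q = 2], which equates the two values of [c]. It also makes the two triangles
    of G, which share the edge [v_3 v_4], contribute equally, so that [tau] is the
    left-hand side of the second condition; the right-hand side is the [tau]
    of H. *)

Set Implicit Arguments.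
Unset Strict Implicit.
Unset Printing Implicit Defensive.

Import GRing.Theory.
Local Open Scope ring_scope.

(** * Characteristic polynomials of direct sums *)

Lemma det_castmx (R : comNzRingType) m n (e : m = n) (A : 'M[R]_m) :
  \det (castmx (e, e) A) = \det A.
Proof. by case: n / e; rewrite castmx_id. Qed.

Lemma det_mxdiag (R : comNzRingType) k n (B : 'I_k -> 'M[R]_n) :
  \det (\mxdiag_b B b) = \prod_b \det (B b).
Proof.
elim: k B => [|k IHk] B; last first.
  by rewrite mxdiag_recl det_castmx det_ublock IHk big_ord_recl.
by rewrite -(det_castmx (big_ord0 _ _ _ _)) det_mx00 big_ord0.
Qed.

Lemma char_poly_mxdiag (R : comNzRingType) k n (B : 'I_k -> 'M[R]_n) :
  char_poly (\mxdiag_b B b) = \prod_b char_poly (B b).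
Proof.
rewrite /char_poly -det_mxdiag; congr (\det _).
rewrite [RHS]mxdiagB mxdiagZ; congr (_ - _).
apply/matrixP=> i j; rewrite !mxE.
by case: eqP => _; rewrite ?conform_mx_id !mxE.
Qed.

(** The two sizes are only propositionally equal, because the lemma serves to
    compare matrices indexed by pairs with block matrices, of size a sum. *)
Lemma char_poly_similar (R : comNzRingType) m n (A : 'M[R]_m) (B : 'M[R]_n)
    (W : 'M_(m, n)) (V : 'M_(n, m)) :
  m = n -> V *m W = 1%:M -> A *m W = W *m B -> char_poly A = char_poly B.
Proof.
move=> e; case: n / e B W V => B W V VW AW.
pose f : 'M_m -> 'M_m := map_mx (@polyC R).
have fVW : f V *m f W = 1%:M by rewrite -map_mxM VW map_mx1.
have dVW : \det (f V) * \det (f W) = 1 by rewrite -det_mulmx fVW det1.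
have eq : char_poly_mx A *m f W = f W *m char_poly_mx B.
  by rewrite mulmxBl mulmxBr -!map_mxM AW scalar_mxC.
rewrite /char_poly -[LHS]mulr1 -dVW [\det (f V) * _]mulrC mulrA -det_mulmx eq.
by rewrite det_mulmx mulrAC [_ * \det (f V)]mulrC dVW mul1r.
Qed.

(** The hypothesis says that column [b] of [Q] is an eigenvector of each block
    [A_(i, j)], of eigenvalue [M b i j]; thus conjugation by [1 (x) Q] followed
    by a reordering of the indices turns [A] into the direct sum of the
    [M b]. *)
Lemma char_poly_eigenbasis (F : fieldType) n k
    (A : 'M[F]_#|{: 'I_n * 'I_k}|) (Q : 'M[F]_k) (M : 'I_k -> 'M[F]_n) :
  Q \in unitmx ->
  (forall i j a b,
     \sum_c A (enum_rank (i, a)) (enum_rank (j, c)) * Q c b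
       = M b i j * Q a b) ->
  char_poly A = \prod_b char_poly (M b).
Proof.
move=> Qu AQ.
(* [W b] has columns [e_j (x) Q_b], and the [V a] stacked on top of each other
   form the inverse of the row of the [W b]. *)
pose W b : 'M_(#|{: 'I_n * 'I_k}|, n) :=
  \matrix_(p, j) (((enum_val p).1 == j)%:R * Q (enum_val p).2 b).
pose V a : 'M_(n, #|{: 'I_n * 'I_k}|) :=
  \matrix_(i, p) ((i == (enum_val p).1)%:R * invmx Q a (enum_val p).2).
have sumE (f : 'I_#|{: 'I_n * 'I_k}| -> F) :
  \sum_p f p = \sum_i \sum_c f (enum_rank (i, c)).
  rewrite pair_bigA (reindex (@enum_rank _)) /=; last first.
    exact: onW_bij (@enum_rank_bij _).
  by apply: eq_bigr => -[].
rewrite -char_poly_mxdiag.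
apply: (@char_poly_similar _ _ _ _ _ (\mxrow_b W b) (\mxcol_a V a)).
- by rewrite card_prod !card_ord sum_nat_const card_ord mulnC.
- rewrite mul_mxcol_mxrow -mxdiagZ; apply: eq_mxblock => a b.
  apply/matrixP=> i j; rewrite !mxE sumE (bigD1 i) //= [X in _ + X]big1 ?addr0.
    have -> : \sum_c V a i (enum_rank (i, c)) * W b (enum_rank (i, c)) j
       = (i == j)%:R * (invmx Q *m Q) a b.
      rewrite mxE mulr_sumr; apply: eq_bigr => c _.
      by rewrite !mxE enum_rankK /= eqxx mul1r mulrCA.
    rewrite mulVmx // !mxE; case: (a == b); last by rewrite mulr0 mxE.
    by rewrite mulr1 conform_mx_id mxE.
  move=> l /negPf li; apply: big1 => c _.
  by rewrite !mxE enum_rankK /= eq_sym li !mul0r.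
- rewrite mul_mxrow mul_mxrow_mxdiag; apply: eq_mxrow => b.
  apply/matrixP=> p j; rewrite -(enum_valK p); case: (enum_val p) => i a.
  rewrite !mxE sumE (bigD1 j) //= [X in _ + X]big1 ?addr0; last first.
    move=> l /negPf li; apply: big1 => c _.
    by rewrite !mxE enum_rankK /= li mul0r mulr0.
  under eq_bigr do rewrite !mxE enum_rankK /= eqxx mul1r.
  rewrite AQ (bigD1 i) //= [X in _ + X]big1 ?addr0.
    by rewrite !mxE enum_rankK /= eqxx mul1r mulrC.
  by move=> l /negPf li; rewrite !mxE enum_rankK /= eq_sym li !mul0r.
Qed.

(** * Eigenvectors of the permutation matrices of a group *)

Lemma group_perm_mx_trK (F : fieldType) k (gT : finGroupType)
    (g : 'I_k -> gT) h :
  bijective g -> (group_perm_mx F g h)^T *m group_perm_mx F g h = 1%:M.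
Proof.
case=> g' gK g'K.
have inj : injective (fun a => g' (g a * h)%g).
  by move=> a b /(can_inj g'K) /mulIg /(can_inj gK).
have -> : group_perm_mx F g h = perm_mx (perm inj).
  by apply/matrixP=> a b; rewrite !mxE permE -(inj_eq (can_inj gK)) g'K.
by rewrite tr_perm_mx -perm_mxM mulVg perm_mx1.
Qed.

Lemma eigen_group_perm_mx (F : fieldType) k (gT : finGroupType)
    (g : 'I_k -> gT) h (X : 'cV[F]_k) (l : F) :
  bijective g -> X != 0 -> group_perm_mx F g h *m X = l *: X ->
  l != 0 /\ (group_perm_mx F g h)^T *m X = l^-1 *: X.
Proof.
move=> gbij X0 PX.
have XE : X = l *: ((group_perm_mx F g h)^T *m X).
  by rewrite scalemxAr -PX mulmxA group_perm_mx_trK // mul1mx.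
have l0 : l != 0 by apply: contraNneq X0 => l0; rewrite XE l0 scale0r.
by split=> //; rewrite [in RHS]XE scalerA mulVf // scale1r.
Qed.

Lemma basis_size (F : fieldType) k (beta : seq 'cV[F]_k) :
  basis_of fullv beta -> size beta = k.
Proof. by move=> /andP[/eqP sp /eqP <-]; rewrite sp dimvf dim_matrix mulr1. Qed.

(** The coordinates of the standard basis in [beta] are a right inverse. *)
Lemma basis_mx_unit (F : fieldType) k (beta : seq 'cV[F]_k) :
  basis_of fullv beta -> (\matrix_(a < k, b < k) beta`_b a 0) \in unitmx.
Proof.
move=> bb; have /eqP sz := basis_size bb.
pose B := Tuple sz.
suff /mulmx1_unit[] : (\matrix_(a < k, b < k) beta`_b a 0)
    *m (\matrix_(b < k, c < k) coord B b (delta_mx c 0)) = 1%:M by [].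
apply/matrixP=> a c; have := @coord_basis _ _ _ _ B (delta_mx c 0) bb (memvf _).
move=> /matrixP/(_ a 0); rewrite summxE !mxE eqxx andbT => ->.
by apply: eq_bigr => b _; rewrite !mxE mulrC.
Qed.

(** * Factorization of the characteristic polynomial of a lift *)

Definition quotient_mx (F : fieldType) (n : nat) (gT : finGroupType)
    (G : sgraph 'I_n) (s : 'I_n -> 'I_n -> gT) (l : gT -> F) : 'M[F]_n :=
  \matrix_(i, j) (if (i, j) \in dotE G then l (s i j)
                  else if (j, i) \in dotE G then (l (s j i))^-1 else 0).

(** Commutativity of the group enters through the two sides on which signs act:
    the lift multiplies by [s i j] on the left, [group_perm_mx] on the
    right. *)
Lemma char_poly_lift (F : fieldType) n k (gT : finGroupType)
    (g : 'I_k -> gT) (G : sgraph 'I_n) (s : 'I_n -> 'I_n -> gT)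
    (beta : seq 'cV[F]_k) (l : 'cV[F]_k -> gT -> F) :
  abelian [set: gT] -> bijective g -> basis_of fullv beta ->
  (forall X, X \in beta -> forall h, h \in sig_image G s ->
     group_perm_mx F g h *m X = l X h *: X) ->
  char_poly (adjmx F (lift_graph g G s)) =
    \prod_(X <- beta) char_poly (quotient_mx G s (l X)).
Proof.
move=> gTab gbij bb lP; have sz := basis_size bb.
rewrite (char_poly_eigenbasis (M := fun b => quotient_mx G s (l beta`_b))
  (basis_mx_unit bb)); first by rewrite (big_nth 0) sz big_mkord.
move=> i j a b.
have Xb : beta`_b \in beta by rewrite mem_nth // sz.
have X0 : beta`_b != 0 by apply: free_not0 Xb; apply: basis_free bb.
have act i' j' c d :
    (s i' j' * g c == g d)%g%:R = group_perm_mx F g (s i' j') c d.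
  by rewrite mxE; have -> : (s i' j' * g c = g c * s i' j')%g
    by apply: (centsP gTab); rewrite inE.
have eig i' j' : (i', j') \in dotE G -> group_perm_mx F g (s i' j') *m beta`_b
    = l beta`_b (s i' j') *: beta`_b.
  by move=> e; apply: lP => //; apply/imsetP; exists (i', j').
have [ijE|/negPf ijE] := boolP ((i, j) \in dotE G).
  have /negPf jiE : (j, i) \notin dotE G.
    by move: ijE; rewrite !inE /= => /andP[ij _]; rewrite ltnNge ltnW.
  have /matrixP/(_ a 0) := eig _ _ ijE; rewrite !mxE ijE => <-.
  apply: eq_bigr => c _.
  rewrite !mxE !enum_rankK /= /lift_adj /lift_arc /= ijE jiE /=.
  by rewrite orbF act mxE.
have [jiE|/negPf jiE] := boolP ((j, i) \in dotE G).
  have [_ /matrixP/(_ a 0)] := eigen_group_perm_mx gbij X0 (eig _ _ jiE).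
  rewrite !mxE ijE jiE => <-; apply: eq_bigr => c _.
  rewrite !mxE !enum_rankK /= /lift_adj /lift_arc /= jiE ijE /=.
  by rewrite act mxE.
rewrite !mxE ijE jiE mul0r; apply: big1 => c _.
by rewrite !mxE !enum_rankK /= /lift_adj /lift_arc /= jiE ijE mul0r.
Qed.

(** * Determinants of sparse matrices *)

(** Expansion along the first row. Zero entries are given as [None]: reduction
    then discards their minors, which keeps the expanded expression short. *)
Fixpoint laplace (R : comNzRingType) n (f : nat -> nat -> option R) : R :=
  if n is m.+1 then
    foldr (fun j acc => if f 0 j is Some a then
        a * ((-1) ^+ j * laplace m (fun a b => f a.+1 (bump j b))) + acc
      else acc) 0 (iota 0 n)
  else 1.

Lemma det_laplace (R : comNzRingType) n (A : 'M[R]_n)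
    (f : nat -> nat -> option R) :
  (forall i j, A i j = odflt 0 (f i j)) -> \det A = laplace n f.
Proof.
elim: n A f => [|n IHn] A f Af; first by rewrite det_mx00.
pose minor j := laplace n (fun a b => f a.+1 (bump j b)).
have sumE s : foldr (fun j acc => if f 0 j is Some a then
      a * ((-1) ^+ j * minor j) + acc else acc) 0 s
    = \sum_(j <- s) odflt 0 (f 0 j) * ((-1) ^+ j * minor j).
  rewrite unlock; elim: s => //= j s ->.
  by case: (f _ _) => //= *; rewrite mul0r add0r.
rewrite (expand_det_row _ ord0) [RHS](sumE (index_iota 0 n.+1)) big_mkord.
apply: eq_bigr => j _; rewrite Af /cofactor add0n; congr (_ * (_ * _)).
by apply: IHn => a b; rewrite !mxE Af.
Qed.

Definition sparse_entry (R : Type) (rows : seq (seq (option R))) i j :=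
  nth None (nth [::] rows i) j.

(** * The two base graphs *)

(** [sparseG] and [sparseH] are [t - M] for [M] the weighted adjacency matrices
    of G and H, a primed letter being the weight of the reversed arc. The
    inverse weights are separate variables so that the determinants
    can be evaluated in a polynomial ring. *)
Section WeightedGraphs.
Variable R : comNzRingType.
Let S := @Some R.
Let O := @None R.

Definition sparseG (t u v w x y z r u' v' w' x' y' z' r' : R) :=
  [:: [:: S t; S (- u); O; O; O; O];
      [:: S (- u'); S t; S (- v); S (- w); O; O];
      [:: O; S (- v'); S t; S (- x); S (- y); O];
      [:: O; S (- w'); S (- x'); S t; S (- z); O];
      [:: O; O; S (- y'); S (- z'); S t; S (- r)];
      [:: O; O; O; O; S (- r'); S t]].

Definition sparseH (t u v w x y z r u' v' w' x' y' z' r' : R) :=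
  [:: [:: S t; S (- u); S (- v); O; O; O];
      [:: S (- u'); S t; S (- w); O; O; O];
      [:: S (- v'); S (- w'); S t; S (- x); S (- y); S (- z)];
      [:: O; O; S (- x'); S t; O; O];
      [:: O; O; S (- y'); O; S t; S (- r)];
      [:: O; O; S (- z'); O; S (- r'); S t]].

Variables (t u v w x y z r u' v' w' x' y' z' r' : R).
Hypotheses (hu : u * u' = 1) (hv : v * v' = 1) (hw : w * w' = 1)
  (hx : x * x' = 1) (hy : y * y' = 1) (hz : z * z' = 1) (hr : r * r' = 1).

Lemma laplaceG :
  let tau := x * v * w' + w * (x' * v') + x * z * y' + y * (x' * z') in
  let q := w * z * (y' * v') + y * v * (w' * z') in
  laplace 6 (sparse_entry (sparseG t u v w x y z r u' v' w' x' y' z' r')) =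
    t ^+ 6 - 7%:R * t ^+ 4 - tau * t ^+ 3 + (9%:R - q) * t ^+ 2 + tau * t - 1.
Proof. by move=> /=; ring: hu hv hw hx hy hz hr. Qed.

Lemma laplaceH :
  let tau := y * r * z' + z * (y' * r') + u * w * v' + v * (u' * w') in
  laplace 6 (sparse_entry (sparseH t u v w x y z r u' v' w' x' y' z' r')) =
    t ^+ 6 - 7%:R * t ^+ 4 - tau * t ^+ 3 + 7%:R * t ^+ 2 + tau * t - 1.
Proof. by move=> /=; ring: hu hv hw hx hy hz hr. Qed.

End WeightedGraphs.

Lemma polyC_mulV (F : fieldType) (a : F) : a != 0 -> a%:P * a^-1%:P = 1.
Proof. by move=> a0; rewrite -polyCM divff. Qed.

(** [tau] collects the triangles [v_2 v_3 v_4] and [v_3 v_4 v_5], and [q] the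
    4-cycle [v_2 v_4 v_5 v_3], each cycle in both directions. *)
Lemma char_poly_quotientG (F : fieldType) (gT : finGroupType)
    (s : 'I_6 -> 'I_6 -> gT) (l : gT -> F) :
  let u := l (s 'v_1 'v_2) in let v := l (s 'v_2 'v_3) in
  let w := l (s 'v_2 'v_4) in let x := l (s 'v_3 'v_4) in
  let y := l (s 'v_3 'v_5) in let z := l (s 'v_4 'v_5) in
  let r := l (s 'v_5 'v_6) in
  u != 0 -> v != 0 -> w != 0 -> x != 0 -> y != 0 -> z != 0 -> r != 0 ->
  let tau := x * v / w + w / (x * v) + x * z / y + y / (x * z) in
  let q := w * z / (y * v) + y * v / (w * z) in
  char_poly (quotient_mx graphG s l) =
    'X ^+ 6 - 7%:R * 'X ^+ 4 - tau%:P * 'X ^+ 3 + (9%:R - q%:P) * 'X ^+ 2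
      + tau%:P * 'X - 1.
Proof.
move=> u v w x y z r u0 v0 w0 x0 y0 z0 r0 tau q.
rewrite /tau /q !invfM !(polyCD, polyCM).
rewrite -(laplaceG _ (polyC_mulV u0) (polyC_mulV v0) (polyC_mulV w0)
  (polyC_mulV x0) (polyC_mulV y0) (polyC_mulV z0) (polyC_mulV r0)).
apply: det_laplace => i j; rewrite !mxE !inE.
case: i => [] [|[|[|[|[|[|//]]]]]] hi; rewrite (bool_irrelevance hi isT) {hi};
case: j => [] [|[|[|[|[|[|//]]]]]] hj; rewrite (bool_irrelevance hj isT) {hj};
by rewrite /= ?mulr0n ?mulr1n ?subr0 ?sub0r.
Qed.

(** [tau] collects the triangles [v_3 v_5 v_6] and [v_1 v_2 v_3]. *)
Lemma char_poly_quotientH (F : fieldType) (gT : finGroupType)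
    (s : 'I_6 -> 'I_6 -> gT) (l : gT -> F) :
  let u := l (s 'v_1 'v_2) in let v := l (s 'v_1 'v_3) in
  let w := l (s 'v_2 'v_3) in let x := l (s 'v_3 'v_4) in
  let y := l (s 'v_3 'v_5) in let z := l (s 'v_3 'v_6) in
  let r := l (s 'v_5 'v_6) in
  u != 0 -> v != 0 -> w != 0 -> x != 0 -> y != 0 -> z != 0 -> r != 0 ->
  let tau := y * r / z + z / (y * r) + u * w / v + v / (u * w) in
  char_poly (quotient_mx graphH s l) =
    'X ^+ 6 - 7%:R * 'X ^+ 4 - tau%:P * 'X ^+ 3 + 7%:R * 'X ^+ 2
      + tau%:P * 'X - 1.
Proof.
move=> u v w x y z r u0 v0 w0 x0 y0 z0 r0 tau.
rewrite /tau !invfM !(polyCD, polyCM).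
rewrite -(laplaceH _ (polyC_mulV u0) (polyC_mulV v0) (polyC_mulV w0)
  (polyC_mulV x0) (polyC_mulV y0) (polyC_mulV z0) (polyC_mulV r0)).
apply: det_laplace => i j; rewrite !mxE !inE.
case: i => [] [|[|[|[|[|[|//]]]]]] hi; rewrite (bool_irrelevance hi isT) {hi};
case: j => [] [|[|[|[|[|[|//]]]]]] hj; rewrite (bool_irrelevance hj isT) {hj};
by rewrite /= ?mulr0n ?mulr1n ?subr0 ?sub0r.
Qed.

(** The first condition makes the 4-cycle of G have weight 1 and the two
    triangles of G contribute equally; the second one then equates the remaining
    coefficients, those of [t^3] and [t]. *)
Lemma char_poly_quotient_eq (F : fieldType) (gT : finGroupType)
    (s s' : 'I_6 -> 'I_6 -> gT) (l : gT -> F) :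
  (forall i j, (i, j) \in dotE graphG -> l (s i j) != 0) ->
  (forall i j, (i, j) \in dotE graphH -> l (s' i j) != 0) ->
  let v := l (s 'v_2 'v_3) in let w := l (s 'v_2 'v_4) in
  let x := l (s 'v_3 'v_4) in
  let y := l (s 'v_3 'v_5) in let z := l (s 'v_4 'v_5) in
  let u1 := l (s' 'v_1 'v_2) in let v1 := l (s' 'v_1 'v_3) in
  let w1 := l (s' 'v_2 'v_3) in let y1 := l (s' 'v_3 'v_5) in
  let z1 := l (s' 'v_3 'v_6) in let r1 := l (s' 'v_5 'v_6) in
  w / v = y / z ->
  2%:R * (x * v / w + w / (x * v)) =
    y1 * r1 / z1 + z1 / (y1 * r1) + u1 * w1 / v1 + v1 / (u1 * w1) ->
  char_poly (quotient_mx graphG s l) = char_poly (quotient_mx graphH s' l).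
Proof.
move=> nzG nzH v w x y z u1 v1 w1 y1 z1 r1 wvyz tauE.
rewrite char_poly_quotientG ?nzG ?inE // char_poly_quotientH ?nzH ?inE //.
rewrite -/v -/w -/x -/y -/z -/u1 -/v1 -/w1 -/y1 -/z1 -/r1.
have v0 : v != 0 by apply: nzG; rewrite inE.
have w0 : w != 0 by apply: nzG; rewrite inE.
have x0 : x != 0 by apply: nzG; rewrite inE.
have z0 : z != 0 by apply: nzG; rewrite inE.
have yE : y = w * z / v by rewrite mulrAC wvyz divfK.
have -> : w * z / (y * v) + y * v / (w * z) = 2%:R.
  by rewrite yE; field; rewrite v0 w0 z0.
have -> : x * v / w + w / (x * v) + x * z / y + y / (x * z)
    = 2%:R * (x * v / w + w / (x * v)).
  by rewrite yE; field; rewrite v0 w0 x0 z0.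
rewrite tauE.
have -> // : 9%:R - 2%:R%:P = 7%:R :> {poly F}.
by rewrite polyC_natr; ring.
Qed.

(** * Cospectrality *)

Lemma cospectral_char_poly (C : closedFieldType) (T : finType)
    (G H : sgraph T) :
  char_poly (adjmx C G) = char_poly (adjmx C H) -> cospectral C G H.
Proof. by rewrite /cospectral /eigenvalues => ->; exact: perm_refl. Qed.

Lemma eigen_neq0 (F : fieldType) n k (gT : finGroupType) (g : 'I_k -> gT)
    (G : sgraph 'I_n) (s : 'I_n -> 'I_n -> gT) (X : 'cV[F]_k) (l : gT -> F) :
  bijective g -> X != 0 ->
  (forall h, h \in sig_image G s -> group_perm_mx F g h *m X = l h *: X) ->
  forall i j, (i, j) \in dotE G -> l (s i j) != 0.
Proof.
move=> gbij X0 lP i j e.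
have hs : s i j \in sig_image G s by apply/imsetP; exists (i, j).
by have [] := eigen_group_perm_mx gbij X0 (lP _ hs).
Qed.

Lemma cospectral_lifts (C : closedFieldType) (k : nat) (gT : finGroupType)
  (gT_abelian : abelian [set: gT])
  (g : 'I_k -> gT) (g_bij : bijective g)
  (s s' : 'I_6 -> 'I_6 -> gT)
  (beta : seq 'cV[C]_k) (beta_basis : basis_of fullv beta)
  (lambda : 'cV[C]_k -> gT -> C)
  (lambdaP : forall X : 'cV[C]_k, X \in beta ->
     forall h : gT, h \in sig_image graphG s :|: sig_image graphH s' ->
       group_perm_mx C g h *m X = lambda X h *: X)
  (hyp : forall X : 'cV[C]_k, X \in beta ->
     let u := lambda X (s 'v_1 'v_2) in
     let v := lambda X (s 'v_2 'v_3) in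
     let w := lambda X (s 'v_2 'v_4) in
     let x := lambda X (s 'v_3 'v_4) in
     let y := lambda X (s 'v_3 'v_5) in
     let z := lambda X (s 'v_4 'v_5) in
     let r := lambda X (s 'v_5 'v_6) in
     let u1 := lambda X (s' 'v_1 'v_2) in
     let v1 := lambda X (s' 'v_1 'v_3) in
     let w1 := lambda X (s' 'v_2 'v_3) in
     let x1 := lambda X (s' 'v_3 'v_4) in
     let y1 := lambda X (s' 'v_3 'v_5) in
     let z1 := lambda X (s' 'v_3 'v_6) in
     let r1 := lambda X (s' 'v_5 'v_6) in
     w / v = y / z /\
     2%:R * (x * v / w + w / (x * v)) =
       y1 * r1 / z1 + z1 / (y1 * r1) + u1 * w1 / v1 + v1 / (u1 * w1)) :
  cospectral C (lift_graph g graphG s) (lift_graph g graphH s').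
Proof.
have lG X : X \in beta -> forall h, h \in sig_image graphG s ->
    group_perm_mx C g h *m X = lambda X h *: X.
  by move=> Xb h hs; apply: (lambdaP X Xb); rewrite in_setU hs.
have lH X : X \in beta -> forall h, h \in sig_image graphH s' ->
    group_perm_mx C g h *m X = lambda X h *: X.
  by move=> Xb h hs; apply: (lambdaP X Xb); rewrite in_setU hs orbT.
apply: cospectral_char_poly.
rewrite (char_poly_lift gT_abelian g_bij beta_basis lG).
rewrite (char_poly_lift gT_abelian g_bij beta_basis lH).
apply: eq_big_seq => X Xb.
have X0 : X != 0 by apply: free_not0 Xb; apply: basis_free beta_basis.
have [cycle4 triangles] := hyp X Xb.
apply: char_poly_quotient_eq cycle4 triangles.
  exact: eigen_neq0 g_bij X0 (lG X Xb).
exact: eigen_neq0 g_bij X0 (lH X Xb).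
Qed.

Unset Implicit Arguments.

Theorem theorem3 (R : realType) (k : nat) (gT : finGroupType)
  (gT_abelian : abelian [set: gT])
  (g : 'I_k -> gT) (g_bij : bijective g)
  (s s' : 'I_6 -> 'I_6 -> gT)
  (beta : seq 'cV[R[i]]_k) (beta_basis : basis_of fullv beta)
  (lambda : 'cV[R[i]]_k -> gT -> R[i])
  (lambdaP : forall X : 'cV[R[i]]_k, X \in beta ->
     forall h : gT, h \in sig_image graphG s :|: sig_image graphH s' ->
       group_perm_mx R[i] g h *m X = lambda X h *: X)
  (hyp : forall X : 'cV[R[i]]_k, X \in beta ->
     let u := lambda X (s 'v_1 'v_2) in
     let v := lambda X (s 'v_2 'v_3) in
     let w := lambda X (s 'v_2 'v_4) in
     let x := lambda X (s 'v_3 'v_4) in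
     let y := lambda X (s 'v_3 'v_5) in
     let z := lambda X (s 'v_4 'v_5) in
     let r := lambda X (s 'v_5 'v_6) in
     let u1 := lambda X (s' 'v_1 'v_2) in
     let v1 := lambda X (s' 'v_1 'v_3) in
     let w1 := lambda X (s' 'v_2 'v_3) in
     let x1 := lambda X (s' 'v_3 'v_4) in
     let y1 := lambda X (s' 'v_3 'v_5) in
     let z1 := lambda X (s' 'v_3 'v_6) in
     let r1 := lambda X (s' 'v_5 'v_6) in
     w / v = y / z /\
     2%:R * (x * v / w + w / (x * v)) =
       y1 * r1 / z1 + z1 / (y1 * r1) + u1 * w1 / v1 + v1 / (u1 * w1)) :
  cospectral R[i] (lift_graph g graphG s) (lift_graph g graphH s').
Proof.
exact (@cospectral_lifts R[i] k gT gT_abelian g g_bij s s' beta beta_basis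
  lambda lambdaP hyp).
Qed.
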